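(* Let $(K,d)$ be a nonempty compact metric space and let $(\Phi,\|\cdot\|_\Phi)$ be a Banach space of functions included in $C(K)$ (the space of real-valued continuous functions on $K$) which separates the points of $K$ and such that $\alpha\|\varphi\|_\Phi\geq\|\varphi\|_\infty$ for all $\varphi\in\Phi$, for some real number $\alpha>0$. Then the following assertions hold. (1) If $C\neq\emptyset$ is any closed subset of $K$, then $\emptyset\neq\Phi\mathrm{Exp}(C)\subset\Phi\mathrm{Ext}(C)$. (2) Let $I$ be any nonempty set and let $f_i\in\Phi\mathcal{C}(K)$ for all $i\in I$. Suppose that $\bigcap_{i\in I}K_{\max}(f_i)\neq\emptyset$. Then $$\Phi\mathrm{Exp}\Big(\bigcap_{i\in I}K_{\max}(f_i)\Big)\cap\Phi\mathrm{Ext}(K)\neq\emptyset.$$ In particular, there exists a common $\Phi$-extremal point $e$ of $K$ such that $f_i$ attains its maximum over $K$ at $e$ for all $i\in I$. (3) Let $\mathcal{B}$ be any $\Phi$-stable subspace of $(\Phi\mathcal{C}(K),\rho_\infty)$. Then the set $$\mathcal{G}:=\{f\in\mathcal{B}:\ K_{\max}(f)\cap\Phi\mathrm{Ext}(K)\text{ is a singleton}\}$$ is a $G_\delta$ dense subset of $(\mathcal{B},\rho_\infty)$.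
   Context: $\|\cdot\|_\infty$ is the sup-norm on $C(K)$. $\Phi$-between: for $a,x,y\in K$, $a$ is $\Phi$-between $x$ and $y$ if for every $\varphi\in\Phi$, $\varphi(x)\le\varphi(a)$ and $\varphi(y)\le\varphi(a)$ imply $\varphi(a)=\varphi(x)=\varphi(y)$. $\Phi$-extremal points: for a nonempty set $B\subset K$, a point $a\in B$ is $\Phi$-extremal in $B$ if whenever $x,y\in B$ and $a$ is $\Phi$-between $x$ and $y$, then $x=a=y$. The set of $\Phi$-extremal points of $B$ is $\Phi\mathrm{Ext}(B)$. $\Phi$-exposed points: for a nonempty set $C\subset K$, a point $x\in C$ is $\Phi$-exposed in $C$ if there is $\varphi\in\Phi$ with $\varphi(x)>\varphi(y)$ for all $y\in C\setminus\{x\}$. The set of such points is $\Phi\mathrm{Exp}(C)$. (Sets are generally assumed to have at least two distinct points, the one-point case being trivial: the strict inequality is then vacuous and the single point is both exposed and extremal.) $\Phi$-convex functions: $f:K\to\mathbb{R}$ is $\Phi$-convex if for all $a,x,y\in K$ such that $a$ is $\Phi$-between $x$ and $y$, $f(x)\le f(a)$ and $f(y)\le f(a)$ imply $f(x)=f(a)=f(y)$. $\Phi\mathcal{C}(K)$ is the set of all real-valued $\Phi$-convex upper semi-continuous functions on $K$, equipped with the metric $$\rho_\infty(f,g):=\sup_{x\in K}\frac{|f(x)-g(x)|}{1+|f(x)-g(x)|}.$$ A subspace (i.e. a subset with the induced metric; it is not required to be a vector space) $\mathcal{B}$ of $\Phi\mathcal{C}(K)$ is $\Phi$-stable if $f+\varphi\in\mathcal{B}$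 for all $f\in\mathcal{B}$ and $\varphi\in\Phi$. For $f\in\Phi\mathcal{C}(K)$, $K_{\max}(f):=\{x\in K: f(x)=\max_K f\}$. *)

(* Defs.v *)
(* MathComp-Analysis; every notion is relative to a set Phi of functions K -> R. *)
From HB Require Import structures.
From mathcomp Require Import all_boot all_order all_algebra.
From mathcomp Require Import all_classical all_reals all_analysis.
From mathcomp Require Import lra.

Set Implicit Arguments.
Unset Strict Implicit.
Unset Printing Implicit Defensive.

Import Order.TTheory GRing.Theory Num.Theory.
Import numFieldNormedType.Exports.

Local Open Scope classical_set_scope.
Local Open Scope ring_scope.

Section PhiNotions.
Context {R : realType} {K : Type}.
Implicit Types (Phi : set (K -> R)) (B C : set K) (f : K -> R).

Definition phi_between Phi (a x y : K) : Prop :=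
  forall phi, Phi phi -> phi x <= phi a -> phi y <= phi a ->
    phi a = phi x /\ phi x = phi y.

Definition PhiExt Phi B : set K :=
  [set a | B a /\
    forall x y, B x -> B y -> phi_between Phi a x y -> x = a /\ a = y].

Definition PhiExp Phi C : set K :=
  [set x | C x /\
    exists2 phi, Phi phi & forall y, C y -> y <> x -> phi y < phi x].

Definition phi_convex Phi f : Prop :=
  forall a x y, phi_between Phi a x y -> f x <= f a -> f y <= f a ->
    f x = f a /\ f a = f y.

Definition Kmax f : set K := [set x | forall y, f y <= f x].

Definition supnorm f : R := sup (range (fun x => `|f x|)).

Definition separates_points Phi : Prop :=
  forall x y, x <> y -> exists2 phi, Phi phi & phi x <> phi y.

Definition rho_infty (f g : K -> R) : R :=
  sup (range (fun x => `|f x - g x| / (1 + `|f x - g x|))).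

End PhiNotions.

(* Real-valued counterpart of the library's lower_semicontinuous. *)
Definition upper_semicontinuous {R : realType} {K : topologicalType}
    (f : K -> R) : Prop :=
  forall x a, f x < a -> \forall y \near x, f y < a.

(* A record rather than a set of functions: K -> R already carries the
   topology of pointwise convergence, whereas this type is topologized by
   rho_infty. *)
Record PhiC {R : realType} {K : topologicalType} (Phi : set (K -> R)) := MkPhiC {
  PhiC_fun :> K -> R ;
  PhiC_convex : phi_convex Phi PhiC_fun ;
  PhiC_usc : upper_semicontinuous PhiC_fun
}.

Section PhiCMetric.
Context {R : realType} {K : topologicalType} (Phi : set (K -> R)).
Implicit Types f g h : PhiC Phi.

Lemma PhiC_ext f g : (forall x, f x = g x) -> f = g.
Proof.
case: f g => [f cf uf] [g cg ug] /= fg.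
have {}fg : f = g by exact/funext.
by subst g; congr MkPhiC; exact: Prop_irrelevance.
Qed.

HB.instance Definition _ := gen_eqMixin (PhiC Phi).
HB.instance Definition _ := gen_choiceMixin (PhiC Phi).

Let d f g x := `|f x - g x| / (1 + `|f x - g x|).

Let d_le1 f g x : d f g x <= 1.
Proof.
by rewrite ler_pdivrMr ?mul1r ?lerDr// ltr_pwDl.
Qed.

Let d_le_rho f g x : d f g x <= rho_infty f g.
Proof.
apply: ub_le_sup; last by exists x.
by exists 1 => _ [y _ <-]; exact: d_le1.
Qed.

Let rho_le f g c : 0 <= c -> (forall x, d f g x <= c) -> rho_infty f g <= c.
Proof.
move=> c0 dc; rewrite /rho_infty.
have [->|/set0P ne] := eqVneq (range (d f g)) set0; first by rewrite sup0.
by apply: ge_sup => // _ [x _ <-]; exact: dc.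
Qed.

Let d_ge0 f g x : 0 <= d f g x.
Proof. by rewrite divr_ge0// addr_ge0. Qed.

Let rho_ge0 f g : 0 <= rho_infty f g.
Proof.
rewrite /rho_infty; have [->|/set0P[r [x _ _]]] := eqVneq (range (d f g)) set0.
  by rewrite sup0.
exact: le_trans (d_ge0 f g x) (d_le_rho f g x).
Qed.

Lemma rho_inftyxx f : rho_infty f f = 0.
Proof.
apply/eqP; rewrite eq_le rho_ge0 andbT; apply: rho_le => // x.
by rewrite /d subrr normr0 mul0r.
Qed.

Lemma rho_infty_eq0 f g : rho_infty f g = 0 -> f = g.
Proof.
move=> fg0; apply: PhiC_ext => x; apply/eqP; rewrite -subr_eq0 -normr_eq0.
have : d f g x == 0 by rewrite eq_le d_ge0 andbT -fg0 d_le_rho.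
rewrite /d mulf_eq0 invr_eq0 => /orP[//|/eqP].
by have := normr_ge0 (f x - g x); lra.
Qed.

Lemma rho_infty_sym f g : rho_infty f g = rho_infty g f.
Proof.
have E : d f g = d g f by apply/funext => x; rewrite /d distrC.
by rewrite -[LHS]/(sup (range (d f g))) E.
Qed.

Lemma rho_infty_triangle g f h :
  rho_infty f h <= rho_infty f g + rho_infty g h.
Proof.
apply: rho_le => [|x]; first by rewrite addr_ge0.
apply: le_trans (lerD (d_le_rho f g x) (d_le_rho g h x)).
rewrite /d; set p := `|f x - h x|; set q := `|f x - g x|.
set r := `|g x - h x|.
have p0 : 0 <= p := normr_ge0 _.
have q0 : 0 <= q := normr_ge0 _.
have r0 : 0 <= r := normr_ge0 _.
have pqr : p <= q + r.
  by rewrite /p -(subrKA (g x)); exact: ler_normD.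
have step : p / (1 + p) <= (q + r) / (1 + (q + r)).
  rewrite ler_pdivrMr; last by lra.
  rewrite mulrAC ler_pdivlMr; last by lra.
  by nra.
apply: le_trans step _; rewrite mulrDl lerD// ler_wpM2l//.
  by rewrite lef_pV2 ?posrE; lra.
by rewrite lef_pV2 ?posrE; lra.
Qed.

HB.instance Definition _ := isMetric.Build R (PhiC Phi)
  rho_inftyxx rho_infty_eq0 rho_infty_sym rho_infty_triangle.

(* The function f + phi has to be an element of B, in particular Phi-convex. *)
Definition phi_stable (B : set (PhiC Phi)) : Prop :=
  forall f phi, B f -> Phi phi ->
    exists2 g, B g & (g : K -> R) = (fun x => f x + phi x).

End PhiCMetric.

(* Main.v *)
Require Import Defs.
From HB Require Import structures.
From mathcomp Require Import all_boot all_order all_algebra.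
From mathcomp Require Import all_classical all_reals all_analysis.
From mathcomp Require Import borel_hierarchy.
From mathcomp Require Import lra.

Set Implicit Arguments.
Unset Strict Implicit.
Unset Printing Implicit Defensive.

Import Order.TTheory GRing.Theory Num.Theory.
Import numFieldNormedType.Exports.

Local Open Scope classical_set_scope.
Local Open Scope ring_scope.

(** Fix an upper semicontinuous [f] on [K] and study how the set [Kmax (f + v)]
    varies with [v] in the Banach space.  The core is a generic uniqueness
    statement: [f + v] has exactly one maximum point for a dense set of [v]
    ([generic_unique_max]).  It rests on three observations.

    - Along a line [t |-> f + t phi] the values of [phi] on the set of maximum
      points increase with [t].  Being bounded, they cannot jump by [d] at every
      small [t]; hence arbitrarily small multiples of [phi] make the oscillation
      of [phi] on the set of maximum points smaller than [d]
      ([small_slope_avoids]).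
    - Requiring that no pair of maximum points lies in a given closed set [N] of
      pairs is an open condition on the function for uniform distance: on [N]
      the smaller of the two values stays away from the maximum by a uniform gap
      ([max_avoids_stable]).
    - If [N] is moreover disjoint from the diagonal, it is compact and covered by
      finitely many sets on which some member of the Banach space separates the
      two coordinates, so the condition for [N] is implied by finitely many
      open dense ones ([dense_max_avoids]).  Applying this to the pairs at
      distance at least [1 / (n + 1)], for all [n], Baire's theorem concludes.

    Exposed points of a closed set [C] come from applying this to the indicator
    of [C] and a perturbation of sup norm less than [1 / 2]
    ([PhiExp_nonempty]).

    To pass from [C] to [K], call a set a face when it contains both ends [x], [y]
    of any point [a] of it that is between [x] and [y].  Extremal points of a face
    are extremal in [K]; sets of maximum points of Phi-convex functions,
    intersections of faces, and the subset of a face where some [phi] is largest,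
    are all faces.  So every nonempty closed face contains a point extremal in [K]
    ([closed_face_has_extremal]), which gives the second assertion.

    For the third, if [Kmax f] is not a singleton, some [phi] is not constant on
    it, and the two subfaces of [Kmax f] where [phi] and [- phi] are largest yield
    two distinct extremal points of [K].  Hence the set under study is that of
    the [f] with exactly one maximum point ([Kmax_PhiExt_singleton]), a countable
    intersection of open sets by the gap argument, and dense by generic
    uniqueness because a small [v] moves [f] little for [rho_infty]. *)

(** * Upper semicontinuous functions on compact sets *)

(** A substitute for extracting finite subcovers: if [A] failed [P], the sets
    whose complement in [A] satisfies [P] would form a proper filter, and no
    point of [A] could be a cluster point of it. *)
Lemma compact_set_induction (T : topologicalType) (A : set T)
    (P : set T -> Prop) :
  compact A -> P set0 ->
  (forall B C, C `<=` B -> P B -> P C) ->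
  (forall B C, P B -> P C -> P (B `|` C)) ->
  (forall x, A x -> exists2 U, nbhs x U & P (U `&` A)) ->
  P A.
Proof.
move=> Ac P0 Psub PU Ploc.
pose F : set_system T := [set M | P (A `\` M)].
have FF : Filter F.
  split; first by rewrite /F /= setDT.
  - by move=> M N FM FN; rewrite /F /= setDIr; exact: PU.
  - by move=> M N MN; apply: Psub; exact: setDS.
have [//|nPA] := pselect (P A).
have PF : ProperFilter F.
  by split => //; rewrite /F /= setD0.
have FA : F A by rewrite /F /= setDv.
have [x [Ax Fx]] := Ac F PF FA.
have [U xU PUA] := Ploc x Ax.
have FCU : F (~` U) by rewrite /F /= setDE setCK setIC.
by have [y []] := Fx _ _ FCU xU.
Qed.

Section UpperSemicontinuity.
Context {R : realType}.

(** The superlevel sets of [f] at the values it takes on [A] form a filter base;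
    upper semicontinuity makes any cluster point a maximum point. *)
Lemma usc_attains_max (T : topologicalType) (A : set T) (f : T -> R) :
  compact A -> A !=set0 -> upper_semicontinuous f ->
  exists2 a, A a & forall b, A b -> f b <= f a.
Proof.
move=> Ac [a0 Aa0] uscf.
pose F := filter_from A (fun a => A `&` [set y | f a <= f y]).
have FF : Filter F.
  apply: filter_from_filter; first by exists a0.
  move=> a b Aa Ab; have [ab|ba] := leP (f a) (f b).
    by exists b => // y [Ay /= by_]; do 2!split => //=; exact: le_trans by_.
  exists a => // y [Ay /= ay]; do 2!split => //=.
  exact: le_trans (ltW ba) ay.
have PF : ProperFilter F.
  by apply: filter_from_proper => a Aa; exists a; split => /=.
have FA : F A by exists a0 => // y [].
have [a [Aa Fa]] := Ac F PF FA.
exists a => // b Ab; rewrite leNgt; apply/negP => ab.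
have Fb : F (A `&` [set y | f b <= f y]) by exists b.
have [y [[_ /= by_] yb]] := Fa _ _ Fb (uscf a (f b) ab).
by move: yb; rewrite ltNge by_.
Qed.

Lemma uscD_continuous (T : topologicalType) (f g : T -> R) :
  upper_semicontinuous f -> continuous g ->
  upper_semicontinuous (fun x => f x + g x).
Proof.
move=> uscf cg x a fga.
pose e := (a - (f x + g x)) / 2.
have e0 : 0 < e by rewrite /e; lra.
have fe : f x < f x + e by lra.
have ge : g x < g x + e by lra.
near=> y.
have fy : f y < f x + e by near: y; exact: uscf fe.
have gy : g y < g x + e by near: y; exact: (cvgr_lt _ (cg x)) ge.
by move: fy gy; rewrite /e; lra.
Unshelve. all: by end_near. Qed.

Lemma usc_pair_min (T : topologicalType) (f : T -> R) :
  upper_semicontinuous f ->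
  upper_semicontinuous (fun p : T * T => Num.min (f p.1) (f p.2)).
Proof.
move=> uscf p a; rewrite gt_min => /orP[fa|fa].
- exists ([set y | f y < a], setT).
    by split; [exact: uscf|exact: filterT].
  by move=> q [/= qa _]; rewrite gt_min qa.
- exists (setT, [set y | f y < a]).
    by split; [exact: filterT|exact: uscf].
  by move=> q [_ /= qa]; rewrite gt_min qa orbT.
Qed.

Lemma usc_indic_closed (T : topologicalType) (C : set T) :
  closed C -> upper_semicontinuous (\1_C : T -> R).
Proof.
move=> Ccl x a; have [Cx|nCx] := pselect (C x).
  rewrite indicE mem_set// => a1; apply: nearW => y.
  by apply: le_lt_trans a1; rewrite indicE; case: (y \in C).
rewrite indicE memNset// => a0.
have : nbhs x (~` C) by apply: open_nbhs_nbhs; split => //; exact: closed_openC.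
by apply: filterS => y nCy; rewrite indicE memNset.
Qed.

Lemma closed_Kmax (T : topologicalType) (f : T -> R) :
  upper_semicontinuous f -> closed (Kmax f).
Proof.
move=> uscf x clx y; rewrite leNgt; apply/negP => xy.
have [z [zmax /=]] := clx _ (uscf _ _ xy).
by rewrite ltNge zmax.
Qed.

Lemma Kmax_nonempty (T : topologicalType) (f : T -> R) :
  compact [set: T] -> [set: T] !=set0 -> upper_semicontinuous f ->
  Kmax f !=set0.
Proof.
move=> Tc T0 uscf; have [x _ xm] := usc_attains_max Tc T0 uscf.
by exists x => y; exact: xm.
Qed.

End UpperSemicontinuity.

(** * Pairs of maximum points *)

Definition max_avoids {R : realType} {T : Type} (N : set (T * T))
    (f : T -> R) :=
  forall x y, Kmax f x -> Kmax f y -> ~ N (x, y).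

(** The upper semicontinuous function [min (f x) (f y)] attains its maximum on the
    compact set [N]; that maximum is strictly below [max f], because otherwise
    both coordinates of a point of [N] would be maximum points of [f]. *)
Lemma max_avoids_stable {R : realType} (K : topologicalType)
    (N : set (K * K)) (f : K -> R) :
  compact [set: K] -> closed N -> upper_semicontinuous f -> max_avoids N f ->
  exists2 d, 0 < d &
    forall g : K -> R, (forall x, `|f x - g x| < d) -> max_avoids N g.
Proof.
move=> Kc Ncl uscf fN.
have [->|/set0P N0] := eqVneq N set0.
  by exists 1 => // g _ x y _ _; exact.
have Nc : compact N.
  rewrite -[N]setTI; apply: compact_closedI => //.
  by rewrite -setXTT; exact: compact_setX.
have [[x0 y0] Nx0 x0max] := usc_attains_max Nc N0 (usc_pair_min uscf).
have [m mmax] : Kmax f !=set0 by apply: Kmax_nonempty => //; exists x0.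
have gap : Num.min (f x0) (f y0) < f m.
  rewrite ltNge; apply/negP; rewrite le_min => /andP[mx my].
  by apply: (fN x0 y0) => // z; [apply: le_trans mx|apply: le_trans my].
(* Each of the three values involved moves by less than half of the gap. *)
exists ((f m - Num.min (f x0) (f y0)) / 2).
  by rewrite divr_gt0// subr_gt0.
move=> g fg x y gx gy Nxy.
have /= := x0max _ Nxy; rewrite leNgt => /negP; apply.
rewrite lt_min; move: (fg m) (fg x) (fg y) (gx m) (gy m).
rewrite !ltr_norml => /andP[? ?] /andP[? ?] /andP[? ?] ? ?.
by apply/andP; split; lra.
Qed.

Section DistantPairs.
Context {R : realType} {K : metricType R}.

Definition dist_ge (n : nat) : set (K * K) :=
  [set p | n.+1%:R^-1 <= mdist p.1 p.2].

Lemma closed_dist_ge n : closed (dist_ge n).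
Proof.
rewrite -[dist_ge n]setCK /dist_ge; set q := n.+1%:R^-1.
apply: open_closedC; rewrite openE => -[x y] /= /negP.
rewrite -ltNge => xy.
pose r := (q - mdist x y) / 2.
have r0 : 0 < r by rewrite divr_gt0// subr_gt0.
exists (ball x r, ball y r); first by split; exact: nbhsx_ballx.
move=> [a b] [/=]; rewrite !ballEmdist/= => xa yb; apply/negP; rewrite -ltNge.
apply: le_lt_trans (metric_triangle a x b) _.
rewrite (metric_sym a x).
apply: le_lt_trans (lerD (lexx _) (metric_triangle x y b)) _.
by move: xa yb; rewrite /r; lra.
Qed.

Lemma dist_ge_irrefl n x : ~ dist_ge n (x, x).
Proof. by rewrite /dist_ge/= mdistxx leNgt invr_gt0 ltr0Sn. Qed.

Lemma max_avoids_dist_ge (f : K -> R) : Kmax f !=set0 ->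
  (exists x, Kmax f = [set x]) <-> forall n, max_avoids (dist_ge n) f.
Proof.
move=> [x xm]; split.
  by move=> [z fz] n a b; rewrite fz => -> ->; exact: dist_ge_irrefl.
move=> fn; exists x; apply/seteqP; split => [y ym|y ->//].
apply/eqP; apply: contrapT => /negP; rewrite -mdist_gt0 => yx.
have [n nyx] := ltr_add_invr yx.
by apply: (fn n y x) => //; rewrite /dist_ge/= ltW// -[ltLHS]add0r.
Qed.

End DistantPairs.

(** * Perturbation along one direction *)

(** Add the two maximality inequalities at [x] and at [y]. *)
Lemma Kmax_slope_mono {R : realType} (T : Type) (f phi : T -> R) (s t : R) x y :
  s < t -> Kmax (fun z => f z + t * phi z) x ->
  Kmax (fun z => f z + s * phi z) y -> phi y <= phi x.
Proof.
move=> st /(_ y) /= xt /(_ x) /= ys.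
have : (t - s) * (phi y - phi x) <= 0 by lra.
by rewrite pmulr_rle0 ?subr_gt0// subr_le0.
Qed.

(** Suppose that [phi] oscillates by at least [d] on the maximum points for every
    slope in the interval from [0] to [e]; then the infimum [inf S] of the values
    of [phi] on all these maximum points exceeds itself by [d]. *)
Lemma small_slope_avoids {R : realType} (K : topologicalType)
    (f phi : K -> R) (d e : R) :
  compact [set: K] -> [set: K] !=set0 -> upper_semicontinuous f ->
  continuous phi -> 0 < d -> 0 < e ->
  exists t, [/\ 0 < t, t < e & max_avoids
    [set p | d <= `|phi p.1 - phi p.2|] (fun x => f x + t * phi x)].
Proof.
move=> Kc K0 uscf cphi d0 e0; apply: contrapT => /forallNP bad.
pose S := [set r | exists t x, [/\ 0 < t, t < e,
  Kmax (fun x => f x + t * phi x) x & r = phi x]].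
have ct t : continuous (fun x => t * phi x).
  by move=> x; apply: cvgM; [exact: cvg_cst|exact: cphi].
have Smax t : Kmax (fun x => f x + t * phi x) !=set0.
  by apply: Kmax_nonempty => //; exact: uscD_continuous.
have S0 : S !=set0.
  have [x xm] := Smax (e / 2); exists (phi x), (e / 2), x.
  by split => //; lra.
have Slb : has_lbound S.
  have [|m _ mm] := compact_EVT_min K0 Kc (f := phi).
    exact: continuous_subspaceT.
  by exists (phi m) => _ [t [x [_ _ _ ->]]]; apply: mm; rewrite inE.
(* At the slope [t / 2], one of two bad maximum points has a value of [phi] at
   least [inf S + d], and the values at the slope [t] are not smaller. *)
have : inf S + d <= inf S.
  apply: lb_le_inf => // _ [t [x [t0 te xm ->]]].
  have := bad (t / 2) => /not_and3P.
  have t20 : 0 < t / 2 by lra.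
  have t2e : t / 2 < e by lra.
  case=> // /existsNP[y /existsNP[z /not_implyP[ym]]].
  move=> /not_implyP[zm /contrapT/= dyz].
  have t2t : t / 2 < t by lra.
  have yx := Kmax_slope_mono t2t xm ym.
  have zx := Kmax_slope_mono t2t xm zm.
  have Sy : inf S <= phi y by apply: ge_inf => //; exists (t / 2), y.
  have Sz : inf S <= phi z by apply: ge_inf => //; exists (t / 2), z.
  by move: dyz; rewrite ler_normr => /orP[]; lra.
by lra.
Qed.

(** * Faces *)

Section Faces.
Context {R : realType} {K : Type} (Phi : set (K -> R)).
Implicit Types (A C : set K) (f : K -> R).

(** An exposing [phi] is at most [phi a] at both ends [x] and [y], so betweenness
    forces equality there, which strict exposure allows at [a] only. *)
Lemma PhiExp_sub_PhiExt C : PhiExp Phi C `<=` PhiExt Phi C.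
Proof.
move=> a [Ca [phi Pphi aphi]]; split => // x y Cx Cy axy.
have le_a z : C z -> phi z <= phi a.
  by move=> Cz; have [->//|za] := pselect (z = a); exact: ltW (aphi z Cz za).
have [ax xy] := axy phi Pphi (le_a x Cx) (le_a y Cy).
have eq_a z : C z -> phi z = phi a -> z = a.
  by move=> Cz za; apply: contrapT => /(aphi z Cz); rewrite za ltxx.
by split; [|apply/esym]; apply: eq_a => //; rewrite ax// xy.
Qed.

Definition phi_face A :=
  forall a x y, A a -> phi_between Phi a x y -> A x /\ A y.

Lemma PhiExt_phi_face A : phi_face A -> PhiExt Phi A `<=` PhiExt Phi [set: K].
Proof.
move=> faceA a [Aa aext]; split => // x y _ _ axy.
by have [Ax Ay] := faceA _ _ _ Aa axy; exact: aext.
Qed.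

(** At a maximum point of [f] the premises of Phi-convexity hold for free. *)
Lemma phi_face_Kmax f : phi_convex Phi f -> phi_face (Kmax f).
Proof.
move=> fconv a x y am axy; have [xa ay] := fconv a x y axy (am x) (am y).
by split => z; [rewrite xa|rewrite -ay].
Qed.

Lemma phi_face_bigcap I (F : I -> set K) :
  (forall i, phi_face (F i)) -> phi_face (\bigcap_(i in [set: I]) F i).
Proof.
move=> faceF a x y Fa axy.
by split => i _; have [] := faceF i a x y (Fa i Logic.I) axy.
Qed.

(** At a point where [phi] is largest over [A], both ends satisfy the premises of
    betweenness for [phi], hence carry the same value of [phi]. *)
Lemma phi_face_argmax A phi : Phi phi -> phi_face A ->
  phi_face (A `&` [set x | forall y, A y -> phi y <= phi x]).
Proof.
move=> Pphi faceA a x y [Aa am] axy.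
have [Ax Ay] := faceA _ _ _ Aa axy.
have [ax xy] := axy phi Pphi (am _ Ax) (am _ Ay).
by split; split => // z /am; rewrite ax// xy.
Qed.

End Faces.

(** * The metric of uniform convergence *)

Section RhoInfty.
Context {R : realType} {K : Type}.
Implicit Types f g : K -> R.

Lemma rho_infty_lt f g d x : 0 < d ->
  rho_infty f g < d / (1 + d) -> `|f x - g x| < d.
Proof.
move=> d0 fgd; set a := `|f x - g x|.
have a0 : 0 <= a := normr_ge0 _.
have : a / (1 + a) < d / (1 + d).
  apply: le_lt_trans fgd; apply: ub_le_sup; last by exists x.
  exists 1 => _ [y _ <-].
  by rewrite ler_pdivrMr ?mul1r ?lerDr// ltr_pwDl.
rewrite ltr_pdivrMr; last by lra.
rewrite mulrAC ltr_pdivlMr; last by lra.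
by nra.
Qed.

Lemma rho_infty_le f g c : [set: K] !=set0 ->
  (forall x, `|f x - g x| <= c) -> rho_infty f g <= c.
Proof.
move=> [x0 _] fgc; apply: ge_sup; first by eexists; exists x0.
move=> _ [x _ <-]; apply: le_trans (fgc x).
by rewrite ler_pdivrMr ?ltr_pwDl// ler_peMr// lerDl.
Qed.

End RhoInfty.

Lemma open_PhiC_max_avoids {R : realType} (K : topologicalType)
    (Phi : set (K -> R)) (N : set (K * K)) :
  compact [set: K] -> closed N ->
  open [set f : PhiC Phi | max_avoids N f].
Proof.
move=> Kc Ncl; rewrite openE => f fN.
have [d d0 dN] := max_avoids_stable Kc Ncl (@PhiC_usc _ _ _ f) fN.
(* [t / (1 + t)] is increasing, so this radius bounds [`|f x - g x|] by [d]. *)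
apply/nbhs_ballP; exists (d / (1 + d)); first by rewrite /= divr_gt0// addr_gt0.
move=> g; rewrite ballEmdist => fg; apply: dN => x.
exact: rho_infty_lt.
Qed.

(** * Generic perturbation by a Banach space of functions *)

Section BanachPerturbation.
Context {R : realType} {K : metricType R} {V : completeNormedModType R}.
Context (ev : {linear V -> (K -> R^o)}) (alpha : R).
Hypothesis K0 : [set: K] !=set0.
Hypothesis Kc : compact [set: K].
Hypothesis ev_cont : forall v, continuous (ev v : K -> R).
Hypothesis ev_sep : forall x y : K, x <> y -> exists v, ev v x <> ev v y.
Hypothesis alpha0 : 0 < alpha.
Hypothesis ev_le : forall (v : V) x, `|ev v x : R| <= alpha * `|v|.

Definition perturb (f : K -> R) (v : V) : K -> R := fun x => f x + ev v x.

Lemma usc_perturb f v :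
  upper_semicontinuous f -> upper_semicontinuous (perturb f v).
Proof. by move=> uscf; apply: uscD_continuous. Qed.

Lemma open_max_avoids N f : closed N -> upper_semicontinuous f ->
  open [set v | max_avoids N (perturb f v)].
Proof.
move=> Ncl uscf; rewrite openE => v vN.
have [d d0 dN] := max_avoids_stable Kc Ncl (usc_perturb (v := v) uscf) vN.
apply/nbhs_normP; exists (d / alpha); first by rewrite /= divr_gt0.
move=> w /= vw; apply: dN => x.
have -> : perturb f v x - perturb f w x = ev (v - w) x.
  by rewrite /perturb linearB/= opprD addrACA subrr add0r.
apply: le_lt_trans (ev_le _ _) _.
by rewrite mulrC -ltr_pdivlMr.
Qed.

Lemma dense_max_avoids_slope f (w : V) d : upper_semicontinuous f -> 0 < d ->
  dense [set v | max_avoids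
    [set p : K * K | d <= `|ev w p.1 - ev w p.2 : R|] (perturb f v)].
Proof.
move=> uscf d0 O [v0 Ov0] Oop.
have /nbhs_normP[r /= r0 rO] : nbhs v0 O by exact: open_nbhs_nbhs.
(* The summand 1 only keeps the denominator positive. *)
have e0 : 0 < r / (1 + `|w|) by rewrite divr_gt0// ltr_pwDl.
have [t [t0 te tN]] :=
  small_slope_avoids Kc K0 (usc_perturb (v := v0) uscf) (@ev_cont w) d0 e0.
exists (v0 + t *: w); split.
  apply: rO; rewrite /= opprD addrA subrr add0r normrN normrZ gtr0_norm//.
  apply: le_lt_trans (_ : t * (1 + `|w|) < _).
    by rewrite ler_pM2l// lerDr.
  by rewrite -ltr_pdivlMr// ltr_pwDl.
rewrite /=; congr (max_avoids _ _) : tN; apply/funext => x.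
by rewrite /perturb linearD linearZ/= addrA.
Qed.

(** By compactness it suffices to treat a neighbourhood of a pair [(x, y)] of
    [N]; a [w] separating [x] from [y] still separates, by a fixed amount, the
    coordinates of all nearby pairs, and the one-direction case applies. *)
Lemma dense_max_avoids N f : closed N -> (forall x, ~ N (x, x)) ->
  upper_semicontinuous f -> dense [set v | max_avoids N (perturb f v)].
Proof.
move=> Ncl Ndiag uscf.
(* Openness is part of [P]: the intersection of two dense sets is dense as soon
   as one of them is open. *)
pose P M := exists U : set V,
  [/\ open U, dense U & forall v, U v -> max_avoids M (perturb f v)].
suff [U [_ Ud UN]] : P N.
  by move=> O O0 Oop; have [v [Ov /UN vN]] := Ud O O0 Oop; exists v.
apply: compact_set_induction.
- rewrite -[N]setTI; apply: compact_closedI => //.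
  by rewrite -setXTT; exact: compact_setX.
- exists setT; split; [exact: openT| |by move=> v _ x y _ _; exact].
  by move=> O [v Ov] _; exists v.
- move=> B C CB [U [Uo Ud UB]]; exists U; split => // v /UB vB x y xm ym /CB.
  exact: vB.
- move=> B C [U [Uo Ud UB]] [W [Wo Wd WC]]; exists (U `&` W); split.
  + exact: openI.
  + exact: denseI.
  + by move=> v [/UB vB /WC vC] x y xm ym [/vB|/vC]; apply.
- move=> [x y] Nxy.
  have xy : x <> y by move=> xy; apply: (Ndiag x); rewrite {2}xy.
  have [w wxy] := ev_sep xy.
  pose h (p : K * K) : R := `|ev w p.1 - ev w p.2|.
  have ch : continuous h.
    move=> p; apply: cvg_norm; apply: cvgB.
      apply: (cvg_comp fst (ev w : K -> R)
        (@cvg_fst _ _ (nbhs p.1) (nbhs p.2) _)).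
      exact: ev_cont.
    apply: (cvg_comp snd (ev w : K -> R)
      (@cvg_snd _ _ (nbhs p.1) (nbhs p.2) _)).
    exact: ev_cont.
  have h0 : 0 < h (x, y).
    by rewrite normr_gt0 subr_eq0; apply/eqP.
  have h20 : 0 < h (x, y) / 2 by rewrite divr_gt0.
  (* Half of [h (x, y)] leaves room for a neighbourhood of [(x, y)]. *)
  exists [set p | h (x, y) / 2 <= h p].
    have : \forall p \near (x, y), h (x, y) / 2 < h p.
      by have := @cvgr_gt _ _ _ _ h _ (ch (x, y)) (h (x, y) / 2); apply; lra.
    by apply: filterS => p /ltW.
  exists [set v | max_avoids [set p | h (x, y) / 2 <= h p] (perturb f v)].
  split.
  + apply: open_max_avoids => //.
    by apply: (@closed_comp _ _ h [set r | h (x, y) / 2 <= r]) => [p _|];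
      [exact: ch|exact: closed_ge].
  + exact: dense_max_avoids_slope.
  + by move=> v vh a b am bm [hab _]; exact: vh hab.
Qed.

Lemma generic_unique_max f e : upper_semicontinuous f -> 0 < e ->
  exists2 v : V, `|v| < e & exists x, Kmax (perturb f v) = [set x].
Proof.
move=> uscf e0.
have dU : dense (\bigcap_n [set v | max_avoids (dist_ge n) (perturb f v)]).
  apply: Baire => n; split.
    by apply: open_max_avoids => //; exact: closed_dist_ge.
  apply: dense_max_avoids => //; first exact: closed_dist_ge.
  exact: dist_ge_irrefl.
have B0 : ball (0 : V) e !=set0 by exists 0; exact: ballxx.
have [v [ve vm]] := dU _ B0 (ball_open _ _).
exists v; first by move: ve; rewrite -ball_normE/= sub0r normrN.
apply/max_avoids_dist_ge => [|n]; last exact: vm.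
by apply: Kmax_nonempty => //; exact: usc_perturb.
Qed.

(** * Exposed and extremal points *)

Local Notation Phi := (range (ev : V -> K -> R)).

(** The unique maximum point of a perturbed indicator of [C] lies in [C] when the
    perturbation is small, and there the perturbation alone exposes it. *)
Lemma PhiExp_nonempty (C : set K) : closed C -> C !=set0 ->
  PhiExp Phi C !=set0.
Proof.
move=> Ccl [c Cc].
have e0 : 0 < (2 * alpha)^-1 by rewrite invr_gt0 mulr_gt0.
have [v ve [x xE]] := generic_unique_max (usc_indic_closed Ccl) e0.
have xm : Kmax (perturb \1_C v) x by rewrite xE.
have small y : `|ev v y : R| < 1 / 2.
  apply: le_lt_trans (ev_le v y) _; move: ve.
  by rewrite invfM ltr_pdivlMr// mulrC div1r.
(* Outside [C] the perturbed indicator is below [1 / 2], on [C] it is above. *)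
have Cx : C x.
  apply: contrapT => nCx; have := xm c.
  rewrite /perturb !indicE (mem_set Cc) (memNset nCx) /=.
  by move: (small c) (small x); rewrite !ltr_norml => /andP[? ?] /andP[? ?]; lra.
exists x; split => //; exists (ev v); first by exists v.
move=> y Cy yx; rewrite ltNge; apply/negP => xy; apply: yx.
suff : Kmax (perturb \1_C v) y by rewrite xE.
move=> z; apply: le_trans (xm z) _.
by rewrite /perturb !indicE !mem_set// lerD2l.
Qed.

Lemma closed_face_has_extremal A : phi_face Phi A -> closed A -> A !=set0 ->
  PhiExp Phi A `&` PhiExt Phi [set: K] !=set0.
Proof.
move=> faceA Acl A0; have [e eA] := PhiExp_nonempty Acl A0.
by exists e; split => //; exact: PhiExt_phi_face faceA _ (PhiExp_sub_PhiExt eA).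
Qed.

(** If [e] is the only extremal point of [K] in [Kmax f], then every [phi] is
    largest over [Kmax f] at [e], since the subface where it is largest contains
    an extremal point.  Applied to [phi] and [- phi], this makes each [phi]
    constant on [Kmax f], and Phi separates points. *)
Lemma Kmax_PhiExt_singleton (f : K -> R) :
  phi_convex Phi f -> upper_semicontinuous f ->
  (exists e, Kmax f `&` PhiExt Phi [set: K] = [set e]) <->
  exists x, Kmax f = [set x].
Proof.
move=> fconv uscf; have fface := phi_face_Kmax fconv.
have fcl := closed_Kmax uscf; have f0 := Kmax_nonempty Kc K0 uscf.
split=> [[e eE]|[x xE]].
  have ephi (v : V) y : Kmax f y -> (ev v y : R) <= ev v e.
    move=> ym; pose phi : K -> R := ev v.
    pose A := Kmax f `&` [set x | forall y, Kmax f y -> phi y <= phi x].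
    have Acl : closed A.
      rewrite /A; apply: closedI => //.
      have -> : [set x | forall y, Kmax f y -> phi y <= phi x] =
        \bigcap_(y in Kmax f) (phi @^-1` [set r | phi y <= r]) by [].
      apply: closed_bigI => z _; apply: closed_comp (@closed_ge _ _) => x _.
      exact: ev_cont.
    have fc : compact (Kmax f).
      by rewrite -[Kmax f]setTI; apply: compact_closedI.
    have A0 : A !=set0.
      have [|m mf mm] := compact_EVT_max f0 fc (f := phi).
        by apply: continuous_subspaceT; exact: ev_cont.
      by exists m; split; [rewrite -inE|move=> z zf; apply: mm; rewrite inE].
    have Aface : phi_face Phi A by apply: phi_face_argmax => //; exists v.
    have [a [[[af am] _] aE]] := closed_face_has_extremal Aface Acl A0.
    have : [set e] a by rewrite -eE.
    by move=> <-; exact: am.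
  exists e; apply/seteqP; split => [y ym|_ ->]; last first.
    by have [] : (Kmax f `&` PhiExt Phi [set: K]) e by rewrite eE.
  apply: contrapT => /ev_sep[v]; apply.
  apply/eqP; rewrite eq_le ephi//=.
  by have := ephi (- v) y ym; rewrite linearN opprfctE lerN2.
have [e [[em _] eE]] := closed_face_has_extremal fface fcl f0.
have ex : e = x by rewrite xE in em.
exists x; rewrite xE; apply/seteqP; split => [y []//|_ ->].
by split => //; rewrite -ex.
Qed.

End BanachPerturbation.

(** * Variational principle *)

Theorem theorem2 (R : realType) (K : metricType R)
    (V : completeNormedModType R) (ev : {linear V -> (K -> R^o)})
    (Phi : set (K -> R)) (alpha : R) :
  [set: K] !=set0 ->
  compact [set: K] ->
  injective ev ->
  Phi = range (ev : V -> K -> R) ->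
  (forall phi, Phi phi -> continuous phi) ->
  separates_points Phi ->
  0 < alpha ->
  (forall v : V, supnorm (ev v : K -> R) <= alpha * `|v|) ->
  [/\ (forall C : set K, closed C -> C !=set0 ->
         PhiExp Phi C !=set0 /\ PhiExp Phi C `<=` PhiExt Phi C),
      (forall (I : Type) (f : I -> PhiC Phi), inhabited I ->
         \bigcap_(i in [set: I]) Kmax (f i) !=set0 ->
         PhiExp Phi (\bigcap_(i in [set: I]) Kmax (f i))
             `&` PhiExt Phi [set: K] !=set0 /\
         exists2 e, PhiExt Phi [set: K] e & forall i, Kmax (f i) e) &
      (forall B : set (PhiC Phi), phi_stable B ->
         let G : set (set_type B) :=
           [set f | exists e,
             Kmax (set_val f : PhiC Phi) `&` PhiExt Phi [set: K] = [set e]] in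
         Gdelta G /\ dense G)].
Proof.
move=> K0 Kc _ PhiE Phi_cont Phi_sep alpha0 ev_sup.
have ev_cont v : continuous (ev v : K -> R).
  by apply: Phi_cont; rewrite PhiE; exists v.
have ev_sep x y : x <> y -> exists v, ev v x <> ev v y.
  by move=> /Phi_sep[phi]; rewrite PhiE => -[v _ <-]; exists v.
have ev_le v x : `|ev v x : R| <= alpha * `|v|.
  apply: le_trans (ev_sup v); apply: ub_le_sup; last by exists x.
  have [|m _ mm] := compact_EVT_max K0 Kc (f := fun x => `|ev v x : R|).
    apply: continuous_subspaceT => y; apply: cvg_norm; exact: ev_cont.
  by exists `|ev v m : R| => _ [y _ <-]; apply: mm; rewrite inE.
subst Phi; set Phi := range (ev : V -> K -> R).
split.
- move=> C Ccl C0; split; last exact: PhiExp_sub_PhiExt.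
  exact: (PhiExp_nonempty K0 Kc ev_cont ev_sep alpha0 ev_le).
- move=> I f _ M0.
  have faceM : phi_face Phi (\bigcap_(i in [set: I]) Kmax (f i)).
    by apply: phi_face_bigcap => i; apply: phi_face_Kmax; exact: PhiC_convex.
  have Mcl : closed (\bigcap_(i in [set: I]) Kmax (f i)).
    by apply: closed_bigI => i _; apply: closed_Kmax; exact: PhiC_usc.
  have [e [eM eE]] := closed_face_has_extremal
    K0 Kc ev_cont ev_sep alpha0 ev_le faceM Mcl M0.
  split; first by exists e.
  by exists e => // i; case: eM => + _; apply.
move=> B Bstable G.
have KmaxP (f : PhiC Phi) : (exists e, Kmax f `&` PhiExt Phi [set: K] = [set e])
    <-> exists x, Kmax f = [set x].
  apply: (Kmax_PhiExt_singleton K0 Kc ev_cont ev_sep alpha0 ev_le).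
    exact: PhiC_convex.
  exact: PhiC_usc.
split.
  exists (fun n => set_val @^-1` [set f : PhiC Phi | max_avoids (dist_ge n) f]).
    move=> n; eexists; last reflexivity.
    exact: (open_PhiC_max_avoids Kc (@closed_dist_ge _ _ n)).
  apply/seteqP; split => [g|g gn];
      have g0 := Kmax_nonempty Kc K0 (@PhiC_usc _ _ _ (set_val g)).
    by move=> /KmaxP/(max_avoids_dist_ge g0) gn n _; exact: gn.
  by apply/KmaxP/(max_avoids_dist_ge g0) => n; exact: gn.
move=> O [f Of] [U Uo UO].
have Uf : U (set_val f) by rewrite -UO in Of.
have /nbhs_ballP[e /= e0 eU] : nbhs (set_val f) U by exact: open_nbhs_nbhs.
have ea0 : 0 < e / alpha by rewrite divr_gt0.
have [v ve vmax] := generic_unique_max K0 Kc ev_cont ev_sep alpha0 ev_le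
  (@PhiC_usc _ _ _ (set_val f)) ea0.
have Pv : Phi (ev v) by exists v.
have [g Bg gE] := Bstable _ _ (set_valP f) Pv.
exists (exist _ g (mem_set Bg)); split.
  rewrite -UO; apply: eU; rewrite ballEmdist /=.
  apply: (le_lt_trans (y := alpha * `|v|)); last by rewrite mulrC -ltr_pdivlMr.
  apply: rho_infty_le => // x; rewrite gE opprD addrA subrr add0r normrN.
  exact: ev_le.
by apply/KmaxP; rewrite /= gE.
Qed.
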